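(* Let $d\ge 1$ and $k\ge 1$ be integers. Given a set of $k+d+2$ points in $\mathbb{R}^d$, each coloured with one of $k$ possible colours, there exist two disjoint subsets $A$ and $B$ of it such that $A$ and $B$ contain the same number of points of each colour and $\mathrm{conv}(A)\cap\mathrm{conv}(B)\neq\emptyset$. *)

(* Defs.v *)
From mathcomp Require Import all_boot all_order all_algebra.
Set Implicit Arguments. Unset Strict Implicit. Unset Printing Implicit Defensive.
Import Order.TTheory GRing.Theory Num.Theory.
Local Open Scope ring_scope.

Definition in_conv (R : realFieldType) (d : nat) (I : finType)
  (p : I -> 'rV[R]_d) (A : {set I}) (x : 'rV[R]_d) : Prop :=
  exists w : I -> R,
    [/\ forall i, 0 <= w i,
        forall i, i \notin A -> w i = 0,
        \sum_(i in A) w i = 1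
      & x = \sum_(i in A) w i *: p i].

(* Main.v *)
Require Import Defs.
From mathcomp Require Import all_boot all_order all_algebra.
From mathcomp Require Import boolp lra zify.
Set Implicit Arguments. Unset Strict Implicit. Unset Printing Implicit Defensive.
Import Order.TTheory GRing.Theory Num.Theory.

(* Apply the octahedral Tucker lemma to the pairs (A, B) of disjoint sets of
   points, not both empty: with fewer labels than points, any antipodal
   labelling by signed labels has some pair below another one with the opposite
   label. A pair in which A or B contains more than half of some colour class
   is labelled by that colour. If no such colour exists and A, B are strictly
   separable by an affine hyperplane, the separating vectors of R^(d+1) form a
   convex cone; let t be maximal such that the cone meets the subspace where the
   first t coordinates vanish: on that intersection coordinate t has a constant
   sign, which is the sign of the label t. These k + d + 1 labels never yield
   opposite comparable pairs, so some (A, B) has no label: conv A and conv B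
   meet by Gordan's theorem, and the absence of colour majorities allows one to
   add points until A and B have the same number of points of each colour. *)

(** * The octahedral Tucker lemma *)

Section Facets.
Variable T : Type.

(** The simplicial boundary: chains are counted modulo 2 by [addb]-sums over lists, so no
    orientation signs arise. *)
Fixpoint facets (s : seq T) : seq (seq T) :=
  if s is x :: s' then s' :: map (cons x) (facets s') else [::].

Lemma big_facets_cons x s (G : seq T -> bool) :
  \big[addb/false]_(t <- facets (x :: s)) G t =
  G s (+) \big[addb/false]_(t <- facets s) G (x :: t).
Proof. by rewrite /= big_cons big_map. Qed.

Lemma facets_facets (G : seq T -> bool) (s : seq T) :
  \big[addb/false]_(t <- facets s) \big[addb/false]_(u <- facets t) G u = false.
Proof.
elim: s G => [|x s IHs] G; first by rewrite big_nil.
rewrite big_facets_cons; under [X in _ (+) X]eq_bigr do rewrite big_facets_cons.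
by rewrite big_split /= IHs addbF addbb.
Qed.

(** Leibniz rule for the boundary of a join, [s] being the join of its entries in [P] and its other
    entries. *)
Lemma facets_filter (P : pred T) (G : seq T -> seq T -> bool) (s : seq T) :
  \big[addb/false]_(t <- facets s) G (filter P t) (filter (predC P) t) =
  \big[addb/false]_(t <- facets (filter P s)) G t (filter (predC P) s) (+)
  \big[addb/false]_(t <- facets (filter (predC P) s)) G (filter P s) t.
Proof.
elim: s G => [|x s IHs] G /=; first by rewrite !big_nil.
rewrite big_cons big_map /=; case: (P x) => /=; rewrite big_cons big_map /=.
  by rewrite (IHs (fun u v => G (x :: u) v)) addbA.
by rewrite (IHs (fun u v => G u (x :: v))) addbCA.
Qed.

End Facets.

Lemma facetsP (T : eqType) (s t : seq T) :
  t \in facets s -> subseq t s /\ size s = (size t).+1.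
Proof.
elim: s t => // x s IHs t; rewrite inE => /predU1P[->|].
  by rewrite subseq_cons.
by case/mapP=> u /IHs[us /= ->] ->; rewrite eqxx.
Qed.

Definition flip {T : Type} (l : bool * T) : bool * T := (~~ l.1, l.2).

Lemma flipK T : involutive (@flip T).
Proof. by case=> b x; rewrite /flip /= negbK. Qed.

(* The cochain of Fan's lemma: the absolute values in [s] are distinct and, when
   they are listed in increasing order, the signs alternate, starting with +. *)
Fixpoint alternating m (s : seq (bool * nat)) : bool :=
  if m is m'.+1 then
    let top := [pred l : bool * nat | l.2 == m'] in
    let rest := filter (predC top) s in
    match filter top s with
    | [::] => alternating m' rest
    | [:: l] => (l.1 == ~~ odd (size rest)) && alternating m' rest
    | _ => false
    end
  else nilp s.

Lemma alternating_size m s : alternating m s -> (size s <= m)%N.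
Proof.
elim: m s => [|m IHm] s /=; first by case: s.
set top := (X in filter X s); rewrite -(count_predC top s) -!size_filter.
by case: (filter top s) => [/IHm/leqW|l [/andP[_ /IHm]|]].
Qed.

Lemma alternating_nil m : alternating m [::].
Proof. by elim: m. Qed.

(* Modulo 2 the coboundary of an alternating cochain is the sum of the next one
   and its antipode, provided no two labels are opposite. *)
Lemma alternating_facets m s :
    all (fun l => l.2 < m)%N s -> {in s &, forall l1 l2, l1 != flip l2} ->
    s != [::] ->
  \big[addb/false]_(t <- facets s) alternating m t =
    alternating m s (+) alternating m (map flip s).
Proof.
elim: m s => [[]//|m IHm] s sm sN s0 /=.
set top := [pred l : bool * nat | l.2 == m].
pose G (u v : seq (bool * nat)) := match u with
    | [::] => alternating m v
    | [:: l] => (l.1 == ~~ odd (size v)) && alternating m v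
    | _ => false
    end.
rewrite (facets_filter top G).
rewrite !filter_map.
have -> : filter (preim flip top) s = filter top s by [].
have -> : filter (preim flip (predC top)) s = filter (predC top) s by [].
have rm : all (fun l => l.2 < m)%N (filter (predC top) s).
  apply/allP=> l; rewrite mem_filter => /andP[/= lm /(allP sm)].
  by rewrite ltnS leq_eqVlt (negPf lm).
have rN : {in filter (predC top) s &, forall l1 l2, l1 != flip l2}.
  by move=> l1 l2; rewrite !mem_filter => /andP[_ ?] /andP[_ ?]; apply: sN.
have tN : {in filter top s &, forall l1 l2, l1 = l2}.
  move=> [b1 x1] [b2 x2]; rewrite !mem_filter /=.
  move=> /andP[/eqP-> i1] /andP[/eqP-> i2]; have := sN _ _ i1 i2.
  by rewrite /flip /= xpair_eqE eqxx andbT; case: b1 b2 {i1 i2} => [] [].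
have st : size s = (size (filter top s) + size (filter (predC top) s))%N.
  by rewrite !size_filter count_predC.
rewrite -size_eq0 st in s0.
move: (filter top s) (filter (predC top) s) rm rN tN s0 => u r rm rN tN {st}.
have IHr := IHm r rm rN; rewrite size_map.
(* Cases on the number of labels of top absolute value. With one, dropping an entry of [r] changes
   the sign required of [l]. With two, they are equal and dropping either gives the same value, so
   these facets cancel. With more, every facet still repeats the top label. *)
case: u tN => [|l [|l' u]] tN /= s0.
- by rewrite big_nil IHr // -size_eq0.
- rewrite big_cons big_nil addbF.
  rewrite (eq_big_seq (fun t => (l.1 == odd (size r)) && alternating m t)); last first.
    by move=> t /facetsP[_ ->].
  case: (eqVneq r [::]) => [->|/IHr].
    by rewrite /= big_nil alternating_nil; case: (l.1).
  by rewrite /=; case: (l.1) (odd _) => [] [] /=;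
    rewrite ?big1_eq ?addbF //= => ->; rewrite addbA addbb.
- rewrite /= [X in _ (+) X]big1_eq addbF.
  case: u tN => [|l'' u] tN.
    rewrite !big_cons big_nil /= (tN l l') ?mem_head ?addbF ?addbb //.
    by rewrite !inE eqxx orbT.
  by rewrite /= !big_cons !big_map /= big1_seq.
Qed.

Lemma facets_map (T T' : Type) (f : T -> T') s :
  facets (map f s) = map (map f) (facets s).
Proof. by elim: s => //= x s ->; rewrite -!map_comp. Qed.

Section Subdivision.
Variable T : Type.

(* Barycentric subdivision: the maximal flags of faces of the simplex [s] with
   [n] vertices, the empty face being omitted. *)
Fixpoint subdiv n (s : seq T) : seq (seq (seq T)) :=
  if n is n'.+1 then
    flatten [seq map (cons s) (subdiv n' t) | t <- facets s]
  else [:: [::]].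

Lemma big_subdivS n s (F : seq (seq T) -> bool) :
  \big[addb/false]_(c <- subdiv n.+1 s) F c =
  \big[addb/false]_(t <- facets s) \big[addb/false]_(c <- subdiv n t) F (s :: c).
Proof. by rewrite /= big_flatten big_map; apply: eq_bigr => t _; rewrite big_map. Qed.

End Subdivision.

(** Subdivision is a chain map. Dropping [s] from a flag leaves a flag of a facet of [s]; the flags
    that keep [s] reduce by induction to the boundary of a boundary and cancel. *)
Lemma big_subdiv_facets (T : eqType) n (s : seq T) (F : seq (seq T) -> bool) :
    size s = n.+1 ->
  \big[addb/false]_(c <- subdiv n.+1 s) \big[addb/false]_(c' <- facets c) F c' =
  \big[addb/false]_(t <- facets s) \big[addb/false]_(c <- subdiv n t) F c.
Proof.
elim: n s F => [|n IHn] s F sn.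
  case: s sn => [|x []] //= _.
  by rewrite !(big_cons, big_nil).
rewrite big_subdivS; pose G u := \big[addb/false]_(c <- subdiv n u) F (s :: c).
rewrite (eq_big_seq (fun t => \big[addb/false]_(c <- subdiv n.+1 t) F c (+)
  \big[addb/false]_(u <- facets t) G u)) => [|t /facetsP[_]].
  by rewrite big_split /= facets_facets addbF.
rewrite sn => -[/esym tn]; rewrite -(IHn _ (fun c => F (s :: c))) // -big_split.
by apply: eq_bigr => c _; rewrite big_facets_cons.
Qed.

Lemma subdiv_map (T T' : Type) (f : T -> T') n s :
  subdiv n (map f s) = map (map (map f)) (subdiv n s).
Proof.
elim: n s => //= n IHn s; rewrite map_flatten facets_map -!map_comp.
by congr flatten; apply: eq_map => t /=; rewrite IHn -!map_comp.
Qed.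

Lemma subdivP (T : eqType) n (s : seq T) c :
    size s = n -> c \in subdiv n s ->
  [/\ size c = n, {in c, forall t, t != [::] /\ subseq t s} &
      {in c &, forall t u, subseq t u || subseq u t}].
Proof.
elim: n s c => [|n IHn] s c sn; first by rewrite inE => /eqP->.
case/flatten_mapP=> t /facetsP[ts]; rewrite sn => -[/esym tn].
case/mapP=> {}c /(IHn _ _ tn)[cn ct cc] ->.
have cs u : u \in c -> u != [::] /\ subseq u s.
  by case/ct => -> /subseq_trans->.
split=> [|u|u v]; rewrite /= ?cn // !inE.
  by case/predU1P => [->|/cs//]; rewrite -size_eq0 sn.
case/predU1P=> [->|uc] /predU1P[->|vc]; first by rewrite subseq_refl.
- by rewrite (cs _ vc).2 orbT.
- by rewrite (cs _ uc).2.
- exact: cc.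
Qed.

Section Words.
Variable T : Type.

(* The facets of the cross-polytope with vertices [(true, x)], [(false, x)]. *)
Fixpoint words (L : seq T) : seq (seq (bool * T)) :=
  if L is x :: L' then
    map (cons (true, x)) (words L') ++ map (cons (false, x)) (words L')
  else [:: [::]].

(** The cross-polytope has no boundary: each ridge lies in two facets, which differ in the sign of
    one vertex. *)
Lemma big_words_facets L (G : seq (bool * T) -> bool) :
  \big[addb/false]_(s <- words L) \big[addb/false]_(t <- facets s) G t = false.
Proof.
elim: L G => [|x L IHL] G; first by rewrite big_seq1 big_nil.
rewrite /= big_cat !big_map /=.
under eq_bigr do rewrite big_cons big_map.
under [X in _ (+) X]eq_bigr do rewrite big_cons big_map.
rewrite !big_split /= (IHL (fun t => G (_ :: t))) (IHL (fun t => G (_ :: t))).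
by rewrite !addbF addbb.
Qed.

Lemma big_words_flip L (G : seq (bool * T) -> bool) :
  \big[addb/false]_(s <- words L) G (map flip s) =
  \big[addb/false]_(s <- words L) G s.
Proof.
elim: L G => [|x L IHL] G; first by rewrite !big_seq1.
rewrite /= !big_cat !big_map /= addbC; congr addb.
  exact: (IHL (fun s => G ((true, x) :: s))).
exact: (IHL (fun s => G ((false, x) :: s))).
Qed.

End Words.

Lemma wordsP (T : eqType) (L : seq T) s : s \in words L -> map snd s = L.
Proof.
elim: L s => [|x L IHL] s; first by rewrite inE => /eqP->.
by rewrite /= mem_cat => /orP[] /mapP[t /IHL tL ->] /=; rewrite tL.
Qed.

Lemma words_tucker (T : eqType) (L : seq T) m (lam : seq (bool * T) -> bool * nat) :
    (m < size L)%N -> uniq L ->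
    (forall s, s != [::] -> uniq (map snd s) ->
       (lam s).2 < m /\ lam (map flip s) = flip (lam s))%N ->
    (forall s t, s != [::] -> uniq (map snd t) -> subseq s t ->
       lam s != flip (lam t)) ->
  False.
Proof.
move=> mL uL lamP lamN.
(* The parity [S K] is the same for every [K]: by [big_subdiv_facets] and
   [alternating_facets], both [S (x :: K)] and [S K] are the value of the cochain
   on the boundary of the half-sphere formed by the words starting with
   [(true, x)]. *)
pose S K := \big[addb/false]_(s <- words K)
  \big[addb/false]_(c <- subdiv (size K) s) alternating m (map lam c).
(* The single empty flag makes the count odd for the empty word, whereas flags over all of [L] have
   more than [m] members and cannot alternate. *)
have S0 : S [::] by rewrite /S !big_seq1 alternating_nil.
have SL : ~~ S L.
  rewrite /S big1_seq // => s /andP[_ /wordsP sL].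
  rewrite big1_seq // => c /andP[_]; rewrite -sL size_map.
  case/subdivP=> // cs _ _; apply/negP => /alternating_size.
  by rewrite size_map cs -(size_map snd s) sL leqNgt mL.
have uflip s : uniq (map snd s) -> uniq (map snd (map (@flip T) s)).
  by rewrite -map_comp.
suff SE K : uniq K -> S K by rewrite SE in SL.
elim: K => [//|x K IHK] uK; suff -> : S (x :: K) = S K by case/andP: uK => _ /IHK.
pose F c := alternating m (map lam c).
pose G t := \big[addb/false]_(c <- subdiv (size K) t) F c.
have -> : S K = \big[addb/false]_(s <- words K)
    \big[addb/false]_(t <- facets ((true, x) :: s)) G t.
  under eq_bigr do rewrite big_facets_cons.
  by rewrite big_split (big_words_facets K (fun t => G (_ :: t))) /= addbF.
pose H b s := \big[addb/false]_(c <- subdiv (size K).+1 ((b, x) :: s)) F c.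
(* Reindexing the words that start with [(false, x)] by [flip] pairs each word with its antipode. *)
have -> : S (x :: K) =
    \big[addb/false]_(s <- words K) (H true s (+) H false (map flip s)).
  by rewrite big_split (big_words_flip K (H false)) /S [words _]/= big_cat !big_map.
apply: eq_big_seq => s /wordsP sK.
have sizes : size ((true, x) :: s) = (size K).+1 by rewrite -sK size_map.
rewrite -[RHS]big_subdiv_facets //.
rewrite /H -[(false, x) :: _]/(map flip ((true, x) :: s)) subdiv_map big_map.
rewrite -big_split; apply: eq_big_seq => c cs.
have [cK cs0 cc] := subdivP sizes cs.
have cu t : t \in c -> t != [::] /\ uniq (map snd t).
  case/cs0 => -> /(map_subseq snd) /subseq_uniq -> //.
  by rewrite /= sK.
rewrite -(big_map (map lam) xpredT (alternating m)) -facets_map alternating_facets.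
- congr (_ (+) alternating m _); rewrite -!map_comp; apply/eq_in_map => t /cu[t0 tu] /=.
  by case: (lamP t t0 tu).
- by apply/allP=> _ /mapP[t /cu[t0 tu] ->]; case: (lamP t t0 tu).
- move=> _ _ /mapP[t tc ->] /mapP[u uc ->].
  have [[t0 tu] [u0 uu]] := (cu _ tc, cu _ uc).
  have [/lamN->//|ut] := orP (cc _ _ tc uc).
  by rewrite -(inj_eq (inv_inj (@flipK _))) flipK eq_sym lamN.
- by rewrite -size_eq0 size_map cK.
Qed.
(** [P j A B] allows the label +j on (A, B) and -j on (B, A), so antipodality is built in. A signed
    word stands for the pair of its positive and negative points. *)
Lemma octahedral_tucker (T J : finType) (P : J -> {set T} -> {set T} -> bool) :
    (#|J| < #|T|)%N ->
    (forall A B : {set T}, [disjoint A & B] -> A :|: B != set0 ->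
       exists j, P j A B || P j B A) ->
  exists j (A B A' B' : {set T}), [/\ A \subset A', B \subset B', [disjoint A' & B'],
                          P j A B & P j B' A'].
Proof.
move=> JT Pcover; apply: contrapT => noP.
have {}noP j (A B A' B' : {set T}) : A \subset A' -> B \subset B' -> [disjoint A' & B'] ->
    P j A B -> P j B' A' = false.
  move=> sA sB dis PAB; apply/negP => PBA; apply: noP.
  by exists j, A, B, A', B'.
pose part b (s : seq (bool * T)) := [set x | (b, x) \in s].
have part_flip b s : part b (map flip s) = part (~~ b) s.
  apply/setP=> x; rewrite !inE -{1}[(b, x)]flipK.
  by rewrite (mem_map (inv_inj (@flipK _))).
have part_sub b s t : subseq s t -> part b s \subset part b t.
  by move=> /mem_subseq st; apply/subsetP=> x; rewrite !inE => /st.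
have part_dis b s : uniq (map snd s) -> [disjoint part b s & part (~~ b) s].
  move=> us; apply/pred0P=> x; apply/negbTE/negP => /=; rewrite !inE => /andP[i1 i2].
  elim: s us i1 i2 => //= -[c y] s IHs /andP[/= ys us]; rewrite !inE.
  have notin d : (d, y) \notin s by apply: contra ys; apply: (map_f snd).
  case/predU1P=> [[-> ->]|i1]; last case/predU1P=> [[_ xy]|]; last exact: IHs i1.
    by rewrite (negPf (notin _)) xpair_eqE; case: (c).
  by rewrite xy (negPf (notin _)) in i1.
have part_neq0 s : s != [::] -> part true s :|: part false s != set0.
  case: s => [//|[b x] s] _; apply/set0Pn; exists x.
  by rewrite !inE; case: b; rewrite eqxx ?orbT.
pose Q s j := P j (part true s) (part false s).
(* The picking predicate is invariant under [flip], so antipodal words get the same [j], and the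
   sign tells which of them satisfies [Q]. The default is never reached on nonempty words with
   distinct points. *)
pose lam s := if [pick j | Q s j || Q (map flip s) j] is Some j
  then (Q s j, enum_rank j : nat) else (true, 0%N).
have Qflip s j : Q (map flip s) j = P j (part false s) (part true s).
  by rewrite /Q !part_flip.
have lamP s : s != [::] -> uniq (map snd s) -> exists j,
    lam s = (Q s j, enum_rank j : nat) /\ (Q s j || Q (map flip s) j).
  move=> s0 us; rewrite /lam; case: pickP => [j Qj|Q0]; first by exists j.
  have [j] := Pcover _ _ (part_dis true _ us) (part_neq0 _ s0).
  by rewrite -Qflip -/(Q s j) Q0.
have Qnot s t j : uniq (map snd t) -> subseq s t -> Q s j -> Q (map flip t) j = false.
  move=> ut st; rewrite Qflip; apply: noP; [exact: part_sub..|exact: (part_dis true)].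
have Qnot' s t j : uniq (map snd t) -> subseq s t -> Q (map flip s) j -> Q t j = false.
  move=> ut st; rewrite Qflip; apply: noP; [exact: part_sub..|exact: (part_dis false)].
apply: (@words_tucker _ (enum T) #|J| lam); rewrite -?cardT ?enum_uniq //.
- move=> s s0 us; have [j [lamE Qj]] := lamP s s0 us; rewrite lamE ltn_ord; split=> //.
  rewrite /lam; have flipflip : map flip (map flip s) = s.
    by rewrite -map_comp -[RHS]map_id; apply/eq_map/flipK.
  rewrite flipflip (@eq_pick _ _ (fun j => Q s j || Q (map flip s) j)); last first.
    by move=> i /=; rewrite orbC.
  move: lamE; rewrite /lam; case: pickP => [i Qi|/(_ j)]; last by rewrite Qj.
  case=> _ /ord_inj/enum_rank_inj ->; rewrite /flip /=; congr (_, _).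
  case/orP: Qj => Qj; rewrite Qj.
    by rewrite (Qnot s).
  by rewrite (Qnot' s).
move=> s t s0 ut st.
have us : uniq (map snd s) by apply: subseq_uniq ut; apply: map_subseq.
have t0 : t != [::] by apply: contraNneq s0 => t0; rewrite t0 subseq0 in st.
have [j [-> Qj]] := lamP s s0 us; have [i [-> Qi]] := lamP t t0 ut.
rewrite /flip /= xpair_eqE negb_and; case: (eqVneq (enum_rank j : nat) _); rewrite ?orbT //.
move=> /ord_inj/enum_rank_inj ij; rewrite -{}ij in Qi *; rewrite orbF.
case/orP: Qj => Qj.
  by have := Qnot s t j ut st Qj; move: Qi; rewrite Qj; case: (Q t j) => //= ->.
have := Qnot' s t j ut st Qj; move: Qi => _ ->.
by rewrite (Qnot' s s).
Qed.

Local Open Scope ring_scope.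

(** * Gordan's theorem *)

Definition dot {R : realFieldType} {n} (u v : 'rV[R]_n) : R := \sum_i u 0 i * v 0 i.

Section Dot.
Variables (R : realFieldType) (n : nat).
Implicit Types u v w : 'rV[R]_n.

Lemma dotDl u v w : dot (u + v) w = dot u w + dot v w.
Proof. by rewrite -big_split; apply: eq_bigr => i _; rewrite mxE mulrDl. Qed.

Lemma dotZl a u v : dot (a *: u) v = a * dot u v.
Proof. by rewrite /dot mulr_sumr; apply: eq_bigr => i _; rewrite mxE mulrA. Qed.

Lemma dotC u v : dot u v = dot v u.
Proof. by apply: eq_bigr => i _; rewrite mulrC. Qed.

Lemma dotDr u v w : dot u (v + w) = dot u v + dot u w.
Proof. by rewrite dotC dotDl !(dotC u). Qed.

Lemma dotZr a u v : dot u (a *: v) = a * dot u v.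
Proof. by rewrite dotC dotZl dotC. Qed.

Lemma dot_self_gt0 u : u != 0 -> 0 < dot u u.
Proof.
move=> u0; have sq_ge0 i : true -> 0 <= u 0 i * u 0 i by rewrite -expr2 sqr_ge0.
rewrite lt_def sumr_ge0 // andbT; apply: contraNneq u0 => /psumr_eq0P u0.
by apply/eqP/rowP=> i; rewrite mxE; apply/eqP; rewrite -[_ == _]orbb -mulf_eq0 u0.
Qed.

End Dot.

Lemma exists_small (R : realFieldType) (T : eqType) (s : seq T) (a b : T -> R) :
  {in s, forall x, 0 < a x} ->
  exists2 e, 0 < e & {in s, forall x, 0 < a x + e * b x}.
Proof.
elim: s => [|y s IHs] a0; first by exists 1.
have [x xs|e e0 es] := IHs; first by apply: a0; rewrite inE xs orbT.
have y0 : 0 < a y by apply: a0; rewrite mem_head.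
have c0 : 0 < `|b y| + 1 by rewrite ltr_wpDl.
(* The added 1 avoids a zero denominator and leaves the margin [a y + e' * b y >= e']. *)
pose e' := Num.min e (a y / (`|b y| + 1)).
have e'0 : 0 < e' by rewrite lt_min e0 divr_gt0.
exists e' => // x; rewrite inE => /predU1P[->|xs].
  have : e' * (`|b y| + 1) <= a y by rewrite -ler_pdivlMr // ge_min lexx orbT.
  have : - `|b y| <= b y by rewrite lerNl ler_normr lexx orbT.
  by nra.
have /es : x \in s by []; have : e' <= e by rewrite ge_min lexx.
have : 0 < a x by apply: a0; rewrite inE xs orbT.
by nra.
Qed.

(** Induction on the list, valid over any ordered field: a [w] positive on the tail is kept,
    corrected after a projection, or tilted towards [f y], according to the sign of
    [dot w (f y)]. *)
Lemma gordan (R : realFieldType) n (T : eqType) (s : seq T) (f : T -> 'rV[R]_n) :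
    uniq s ->
  (exists w, {in s, forall x, 0 < dot w (f x)}) \/
  (exists a : T -> R, [/\ forall x, 0 <= a x, exists2 x, x \in s & 0 < a x &
                          \sum_(x <- s) a x *: f x = 0]).
Proof.
elim: s f => [|y s IHs] f /=; first by left; exists 0.
case/andP=> ys us.
have extend (a : T -> R) b : (forall x, 0 <= a x) -> 0 <= b ->
    (exists2 x, x \in s & 0 < a x) \/ 0 < b ->
    b *: f y + \sum_(x <- s) a x *: f x = 0 ->
    exists a : T -> R, [/\ forall x, 0 <= a x,
      exists2 x, x \in y :: s & 0 < a x & \sum_(x <- y :: s) a x *: f x = 0].
  move=> a0 b0 ab eq0; pose a' x := if x == y then b else a x.
  have a's x : x \in s -> a' x = a x.
    by move=> xs; rewrite /a'; case: eqP => // xy; rewrite -xy xs in ys.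
  exists a'; split=> [x||]; first by rewrite /a'; case: eqP.
    case: ab => [[x xs ax]|b1]; last by exists y; rewrite ?mem_head // /a' eqxx.
    by exists x; rewrite ?a's // inE xs orbT.
  rewrite big_cons {1}/a' eqxx -[RHS]eq0; congr (_ + _).
  by apply: eq_big_seq => x /a's ->.
have [[w ws]|[a [a0 a1 a2]]] := IHs f us; last first.
  by right; apply: (extend a 0) => //; [left|rewrite scale0r add0r].
have [wy|wy|wy] := ltrgtP 0 (dot w (f y)).
- by left; exists w => x; rewrite inE => /predU1P[->|/ws].
(* [g] projects along [f y] onto the hyperplane orthogonal to [w]. *)
- set c := dot w (f y) in wy.
  pose g x := f x - (dot w (f x) / c) *: f y.
  have [[v vs]|[a [a0 a1 a2]]] := IHs g us.
    (* [v'] is orthogonal to [f y] and pairs with [f x] as [v] does with [g x]. Since [c < 0],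
       subtracting a small multiple of [w] then makes the value at [y] positive. *)
    left; pose v' := v - (dot v (f y) / c) *: w.
    have v'y : dot v' (f y) = 0.
      rewrite /v' -scaleNr dotDl dotZl -/c mulNr divfK ?subrr //.
      by rewrite lt_eqF.
    have v's : {in s, forall x, 0 < dot v' (f x)}.
      move=> x /vs; congr (_ < _).
      rewrite /v' /g -!scaleNr dotDr dotDl dotZl dotZr.
      by rewrite !mulNr mulrAC [in RHS]mulrAC [dot w _ * _]mulrC.
    have [e e0 es] := exists_small (fun x => - dot w (f x)) v's.
    exists (v' + (- e) *: w) => x; rewrite dotDl dotZl inE => /predU1P[->|/es].
      by rewrite v'y add0r mulNr oppr_gt0 pmulr_rlt0.
    by rewrite mulrN mulNr.
  (* This is the coefficient of [f y] once [g] is expanded in the relation; it is nonnegative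
     because [c < 0]. *)
  right; apply: (extend a (\sum_(x <- s) a x * (dot w (f x) / - c))) => //.
  + rewrite big_seq sumr_ge0 // => x /ws wx.
    by apply: mulr_ge0 => //; apply: divr_ge0; rewrite ?oppr_ge0 ltW.
  + by left.
  rewrite scaler_suml -big_split /= -[RHS]a2; apply: eq_bigr => x _.
  by rewrite /g scalerBr scalerA addrC invrN mulrN mulrN scaleNr.
- have [fy0|fy0] := eqVneq (f y) 0.
    right; apply: (extend (fun=> 0) 1) => //; first by right.
    by rewrite fy0 scaler0 big1 ?addr0 // => x _; rewrite scale0r.
  left; have [e e0 es] := exists_small (fun x => dot (f y) (f x)) ws.
  exists (w + e *: f y) => x; rewrite dotDl dotZl inE => /predU1P[->|/es//].
  by rewrite -wy add0r mulr_gt0 // dot_self_gt0.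
Qed.

(** * Colours and separating hyperplanes *)

Section Colours.
Variables (T J : finType) (col : T -> J).

Definition colour_class (A : {set T}) j := [set i in A | col i == j].

Definition majority A j := (#|colour_class setT j| < #|colour_class A j|.*2)%N.

Lemma colour_classS (A B : {set T}) j :
  A \subset B -> (#|colour_class A j| <= #|colour_class B j|)%N.
Proof.
move=> /subsetP sAB; apply/subset_leq_card/subsetP=> i; rewrite !inE.
by case/andP=> /sAB-> ->.
Qed.

Lemma card_colour_classU (A B : {set T}) j : [disjoint A & B] ->
  #|colour_class (A :|: B) j| = (#|colour_class A j| + #|colour_class B j|)%N.
Proof.
move=> dAB; rewrite -cardsUI [X in (_ + X)%N](_ : _ = 0%N) ?addn0.
  by apply: eq_card => i; rewrite !inE andb_orl.
apply/eqP; rewrite cards_eq0; apply/eqP/setP=> i; rewrite !inE.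
by case: (boolP (i \in A)) => //= iA; rewrite (disjointFr dAB iA) andbF.
Qed.

(** Two disjoint sets cannot both hold more than half of a class; this excludes opposite colour
    labels on comparable pairs. *)
Lemma majority_disjoint (A A' B : {set T}) j :
  A \subset A' -> [disjoint A' & B] -> majority A j -> ~~ majority B j.
Proof.
move=> sA dAB; rewrite /majority => mA; rewrite -leqNgt.
have := colour_classS j sA; have := colour_classS j (subsetT (A' :|: B)).
by rewrite card_colour_classU //; lia.
Qed.

(** In each colour the smaller set is topped up with free points. They suffice: the larger count is
    at most half the class, so the difference is at most the number of free points. *)
Lemma balanced_extension (A B : {set T}) :
    [disjoint A & B] -> (forall j, ~~ majority A j && ~~ majority B j) ->
  exists A' B' : {set T}, [/\ A \subset A', B \subset B', [disjoint A' & B'] &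
    forall j, #|colour_class A' j| = #|colour_class B' j|].
Proof.
move=> dAB bAB; pose Z j := colour_class (~: (A :|: B)) j.
pose U j m := [set i in take m (enum (Z j))].
have UZ j m i : i \in U j m -> [/\ i \notin A, i \notin B & col i = j].
  rewrite inE => /mem_take; rewrite mem_enum !inE negb_or.
  by case/andP=> /andP[-> ->] /eqP.
have cardU j m : (m <= #|Z j|)%N -> #|U j m| = m.
  move=> mZ; rewrite cardsE; have /card_uniqP-> : uniq (take m (enum (Z j))).
    by rewrite take_uniq ?enum_uniq.
  by rewrite size_takel // -cardE.
have U0 j : U j 0%N = set0 by apply/setP=> i; rewrite !inE take0.
clearbody U; pose n C j := #|colour_class C j|.
have cardZ j : (n A j + n B j + #|Z j| = n setT j)%N.
  rewrite /n -!card_colour_classU ?setUCr //.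
  by rewrite -setI_eq0 setICr.
pose fill C m := C :|: [set i | i \in U (col i) (m (col i))].
have card_fill (C : {set T}) m j : (forall i, i \in C -> i \in A :|: B) -> (m j <= #|Z j|)%N ->
    n (fill C m) j = (n C j + m j)%N.
  move=> CAB mZ; rewrite -[m j in RHS](cardU j) // -cardsUI.
  rewrite [X in (_ + X)%N](_ : _ = 0%N) ?addn0; last first.
    apply/eqP; rewrite cards_eq0; apply/eqP/setP=> i; rewrite in_setI !in_set.
    case: (boolP (i \in C)) => //= /CAB; rewrite inE => iAB.
    by apply/negP=> /andP[_] /UZ[/negPf iA /negPf iB _]; rewrite iA iB in iAB.
  apply: eq_card => i; rewrite in_setU !in_set andb_orl; congr orb.
  have [->|ij] := eqVneq (col i) j; first by rewrite andbT.
  rewrite andbF; apply/esym/negP=> /UZ[_ _ cij].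
  by rewrite cij eqxx in ij.
(* By truncated subtraction one of [mA j] and [mB j] is 0, so the two fillings are disjoint although
   both draw from the start of [Z j]. *)
pose mA j := (n B j - n A j)%N; pose mB j := (n A j - n B j)%N.
have mZ j : (mA j <= #|Z j| /\ mB j <= #|Z j|)%N.
  have := bAB j; have := cardZ j; rewrite /majority /mA /mB /n; lia.
exists (fill A mA), (fill B mB); split; rewrite ?subsetUl //.
  apply/pred0P=> i; apply/negP=> /= /andP[]; rewrite !in_setU.
  rewrite !in_set => /orP[iA|iA] /orP[iB|iB].
  - by rewrite (disjointFr dAB iA) in iB.
  - by case/UZ: iB; rewrite iA.
  - by case/UZ: iA; rewrite iB.
  - move: iA iB; rewrite /mA /mB.
    by case/orP: (leq_total (n A (col i)) (n B (col i))) => /eqP->;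
      rewrite U0 inE.
move=> j; rewrite -/(n _ _) -/(n (fill B mB) j).
have [mAZ mBZ] := mZ j; rewrite !card_fill //.
- by rewrite /mA /mB; lia.
- by move=> i iB; rewrite inE iB orbT.
- by move=> i iA; rewrite inE iA.
Qed.

End Colours.

(** * Separation of point sets and common points of their convex hulls *)

Section Radon.
Variables (R : realFieldType) (d : nat) (T : finType) (p : T -> 'rV[R]_d).

(** The coordinate 1 makes affine separation linear, and in a linear relation it records the sum of
    the weights. *)
Definition homogenize (i : T) : 'rV[R]_(d + 1) := row_mx (p i) 1.

Definition separates (w : 'rV[R]_(d + 1)) (A B : {set T}) :=
  (forall i, i \in A -> 0 < dot w (homogenize i)) /\
  (forall i, i \in B -> dot w (homogenize i) < 0).

Lemma big_support (V : nmodType) (A : {set T}) (F : T -> V) :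
  (forall i, i \notin A -> F i = 0) -> \sum_(i in A) F i = \sum_i F i.
Proof.
by move=> F0; rewrite big_mkcond; apply: eq_bigr => i _; case: ifPn => // /F0.
Qed.

Lemma in_convS (A B : {set T}) x : A \subset B -> in_conv p A x -> in_conv p B x.
Proof.
move=> sAB [w [w0 wA w1 ->]].
have wB i : i \notin B -> w i = 0.
  by move=> iB; apply: wA; apply: contra iB; apply: (subsetP sAB).
exists w; split=> //; first by rewrite -w1 !big_support.
by rewrite !big_support // => i => [/wB|/wA] ->; rewrite scale0r.
Qed.

Lemma in_conv_normalize (A : {set T}) (a : T -> R) c :
    (forall i, 0 <= a i) -> 0 < c -> \sum_(i in A) a i = c ->
  in_conv p A (c^-1 *: \sum_(i in A) a i *: p i).
Proof.
move=> a0 c0 ac; exists (fun i => if i \in A then c^-1 * a i else 0); split.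
- by move=> i; case: ifP => // _; rewrite mulr_ge0 // invr_ge0 ltW.
- by move=> i /negPf->.
- under eq_bigr => i iA do rewrite iA.
  by rewrite -mulr_sumr ac mulVf // gt_eqF.
- rewrite scaler_sumr; apply: eq_bigr => i iA; by rewrite iA scalerA.
Qed.

(** Gordan's theorem for the homogenized points, negated on [B]: a relation gives [A] and [B] equal
    weighted sums and the same total weight [c], and division by [c] yields the common point. *)
Lemma separable_or_radon (A B : {set T}) :
    [disjoint A & B] -> A :|: B != set0 ->
  (exists w, separates w A B) \/ (exists x, in_conv p A x /\ in_conv p B x).
Proof.
move=> dAB AB0; pose f i := if i \in A then homogenize i else - homogenize i.
case: (gordan f (enum_uniq (A :|: B))) => [[w ws]|[a [a0 [x0 x0s ax0] a2]]].
  left; exists w; split=> i iAB; have := ws i; rewrite mem_enum inE /f.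
    by rewrite iAB => ->.
  rewrite (disjointFl dAB iAB) iAB => /(_ isT).
  by rewrite -scaleN1r dotZr mulN1r oppr_gt0.
right; have dE (V : nmodType) (F : T -> V) :
    \sum_(i in A :|: B) F i = \sum_(i in A) F i + \sum_(i in B) F i.
  by rewrite -bigU //; apply: eq_bigl => i; rewrite !inE.
have eqAB : \sum_(i in A) a i *: homogenize i = \sum_(i in B) a i *: homogenize i.
  apply/eqP; rewrite -subr_eq0; move: a2; rewrite big_enum /= dE => a2.
  rewrite -[X in _ == X]a2 -sumrN; apply/eqP; congr (_ + _).
    by apply: eq_bigr => i iA; rewrite /f iA.
  by apply: eq_bigr => i iB; rewrite /f (disjointFl dAB iB) scalerN.
have sum_homogenize (C : {set T}) : \sum_(i in C) a i *: homogenize i =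
    row_mx (\sum_(i in C) a i *: p i) (\sum_(i in C) a i)%:M.
  elim/big_rec3: _ => [|i x y z _ ->]; first by rewrite raddf0 row_mx0.
  by rewrite /homogenize scale_row_mx scalemx1 add_row_mx raddfD.
have [eqp eq1] := eq_row_mx (etrans (esym (sum_homogenize A)) (etrans eqAB (sum_homogenize B))).
have {}eq1 : \sum_(i in A) a i = \sum_(i in B) a i.
  by have := congr1 (fun M : 'M_1 => M 0 0) eq1; rewrite !mxE eqxx.
pose c := \sum_(i in A) a i.
have c0 : 0 < c.
  have a0' i : i \in A :|: B -> 0 <= a i by [].
  have : 0 < \sum_(i in A :|: B) a i.
    rewrite lt_def sumr_ge0 // andbT; apply/eqP=> /(psumr_eq0P a0')/(_ x0).
    by rewrite -mem_enum => /(_ x0s) ax; rewrite ax ltxx in ax0.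
  by rewrite dE -eq1 -/c; lra.
exists (c^-1 *: \sum_(i in A) a i *: p i); split; last rewrite eqp.
  exact: in_conv_normalize.
by apply: in_conv_normalize; rewrite // -eq1.
Qed.

Definition flag_separates t w A B :=
  separates w A B /\ forall i : 'I_(d + 1), (i < t)%N -> w 0 i = 0.

Lemma separatesN w A B : separates w A B -> separates (- w) B A.
Proof.
by case=> wA wB; split=> i => [/wB|/wA]; rewrite -scaleN1r dotZl mulN1r ?oppr_gt0 ?oppr_lt0.
Qed.

Lemma flag_separatesN t w A B :
  flag_separates t w A B -> flag_separates t (- w) B A.
Proof.
by case=> /separatesN wAB w0; split=> // i /w0 wi; rewrite mxE wi oppr0.
Qed.

Lemma separatesS w (A A' B B' : {set T}) : A \subset A' -> B \subset B' ->
  separates w A' B' -> separates w A B.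
Proof.
by move=> /subsetP sA /subsetP sB [wA wB]; split=> i => [/sA/wA|/sB/wB].
Qed.

(* Contrapositively: a convex cone missing the hyperplane where coordinate [t]
   vanishes lies on one side of it. *)
Lemma flag_separates_sign (t : 'I_(d + 1)) w w' A B :
    flag_separates t w A B -> flag_separates t w' A B ->
    0 < w 0 t -> w' 0 t < 0 ->
  exists w'', flag_separates t.+1 w'' A B.
Proof.
move=> [[wA wB] w0] [[wA' wB'] w0'] wt wt'.
exists (- w' 0 t *: w + w 0 t *: w'); split; first split=> i iX.
- rewrite dotDl !dotZl; have := wA i iX; have := wA' i iX; nra.
- rewrite dotDl !dotZl; have := wB i iX; have := wB' i iX; nra.
move=> i; rewrite ltnS leq_eqVlt !mxE => /predU1P[/ord_inj->|it].
  by rewrite mulNr mulrC addNr.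
by rewrite (w0 i) // (w0' i) // !mulr0 addr0.
Qed.

Lemma flag_separates_last w A B : A :|: B != set0 -> ~ flag_separates (d + 1) w A B.
Proof.
move=> /set0Pn[i iAB] [[wA wB] w0].
have {w0}w0 : w = 0 by apply/rowP=> j; rewrite w0 ?mxE.
have d0 : dot w (homogenize i) = 0 by rewrite w0 -(scale0r 0) dotZl mul0r.
move: iAB; rewrite inE => /orP[/wA|/wB]; by rewrite d0 ltxx.
Qed.

Lemma exists_flag w A B : A :|: B != set0 -> separates w A B ->
  exists t : 'I_(d + 1), (exists w, flag_separates t w A B) /\
                         ~ (exists w, flag_separates t.+1 w A B).
Proof.
move=> AB0 wAB; apply: contrapT => noflag.
suff flag t : (t <= d + 1)%N -> exists w, flag_separates t w A B.
  by have [v /(flag_separates_last AB0)] := flag _ (leqnn _).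
elim: t => [|t IHt] td; first by exists w.
have ft := IHt (ltnW td); apply: contrapT => nft; apply: noflag.
by exists (Ordinal td).
Qed.

End Radon.

(** * The labelling of pairs of point sets *)

Theorem theorem3 (R : realFieldType) (d k : nat) (hd : (1 <= d)%N) (hk : (1 <= k)%N)
  (p : 'I_(k + d + 2) -> 'rV[R]_d) (hp : injective p)
  (col : 'I_(k + d + 2) -> 'I_k) :
  exists A B : {set 'I_(k + d + 2)},
    [/\ [disjoint A & B],
        forall j : 'I_k, #|[set i in A | col i == j]| = #|[set i in B | col i == j]|
      & exists x : 'rV[R]_d, in_conv p A x /\ in_conv p B x].
Proof.
apply: contrapT => noR.
have sep (A B : {set 'I_(k + d + 2)}) : [disjoint A & B] -> A :|: B != set0 ->
    (forall j, ~~ majority col A j && ~~ majority col B j) ->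
    exists w, separates p w A B.
  move=> dAB AB0 bAB; have [//|[x [xA xB]]] := separable_or_radon p dAB AB0.
  have [A' [B' [sA sB dAB' eqAB]]] := balanced_extension dAB bAB.
  case: noR; exists A', B'; split=> //; exists x.
  by split; [exact: in_convS xA|exact: in_convS xB].
(* There is one label fewer than points. For [inr t], the second clause makes [t] maximal and the
   first fixes the sign. *)
pose P (j : 'I_k + 'I_(d + 1)) (A B : {set 'I_(k + d + 2)}) := match j with
  | inl j => majority col A j
  | inr t => `[< (exists w, flag_separates p t w A B /\ 0 < w 0 t) /\
                 ~ (exists w, flag_separates p t.+1 w A B) >]
  end.
have [||j [A [B [A' [B' [sA sB dAB' PAB PBA]]]]]] := @octahedral_tucker _ _ P.
- by rewrite card_sum !card_ord; lia.
- move=> A B dAB AB0; apply: contrapT => noP.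
  have [w wAB] : exists w, separates p w A B.
    apply: sep => // j; rewrite -negb_or; apply/negP=> mj; apply: noP.
    by exists (inl j).
  have [t [[v vAB] nflag]] := exists_flag AB0 wAB.
  apply: noP; exists (inr t); apply/orP.
  have [vt|vt|vt] := ltrgtP 0 (v 0 t).
  + by left; apply/asboolP; split=> //; exists v.
  + right; apply/asboolP; split.
      by exists (- v); split; [exact: flag_separatesN|rewrite mxE oppr_gt0].
    by case=> u /flag_separatesN uAB; apply: nflag; exists (- u).
  + case: nflag; exists v; case: vAB => vAB v0; split=> // i.
    by rewrite ltnS leq_eqVlt => /predU1P[/ord_inj->|/v0].
case: j PAB PBA => [j|t] /=.
  by move=> /(majority_disjoint sA dAB')/negP.
(* Restricted to (A, B), [- v] separates at level [t] like [w] but with the opposite sign at [t];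
   combining the two reaches level [t.+1], against the maximality of [t] for (A, B). *)
move=> /asboolP[[w [wAB wt] nflag]] /asboolP[[v [/flag_separatesN vAB vt] _]].
apply: nflag; apply: (flag_separates_sign wAB _ wt _ (w' := - v)).
  by split; [exact: separatesS vAB.1|exact: vAB.2].
by rewrite mxE oppr_lt0.
Qed.
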